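(* Let $m>n$ and let $\Sigma$ be an $n$-dimensional complete (without boundary) self-shrinker properly immersed in $\mathbb{R}^m$. Let $P$ be a hyperplane of $\mathbb{R}^m$ passing through the origin. If $\Sigma$ lies in a closed halfspace determined by $P$, then $\Sigma\subset P$.
   Context: An $n$-dimensional submanifold $\Sigma$ immersed in $\mathbb{R}^m$, $m>n$, is called a self-shrinker if $\mathbf{H}=-\frac12 X^N$, where $X$ is the position vector, $X^N$ is the component of $X$ normal to $\Sigma$, and $\mathbf{H}=\sum_{i=1}^n(\nabla_{E_i}E_i)^N$ is the mean curvature vector ($\{E_i\}$ a local orthonormal tangent frame of $\Sigma$, $\nabla$ the Euclidean connection), i.e. the trace of the second fundamental form. Inclusions of $\Sigma$ in subsets of $\mathbb{R}^m$ refer to the image of the immersion. *)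

(* Defs.v *)
From HB Require Import structures.
From mathcomp Require Import all_boot all_order all_algebra.
From mathcomp Require Import all_classical all_reals all_analysis.

Set Implicit Arguments.
Unset Strict Implicit.
Unset Printing Implicit Defensive.

Import Order.TTheory GRing.Theory Num.Theory.
Import numFieldNormedType.Exports.

Local Open Scope classical_set_scope.
Local Open Scope ring_scope.

(** * Euclidean structure on ['rV[R]_m]

    The library norm on ['rV[R]_m] is the sup norm.  It is used only through
    its topology; lengths are measured with [enorm]. *)

Definition dot (R : realType) (m : nat) (u v : 'rV[R]_m) : R :=
  \sum_(i < m) u 0 i * v 0 i.

Definition enorm (R : realType) (m : nat) (v : 'rV[R]_m) : R :=
  Num.sqrt (dot v v).

(** The component of [v] orthogonal to the row space of [J]: the rows of
    [kermx J^T] span the orthogonal complement of that row space. *)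
Definition normal_part (R : realType) (n m : nat) (J : 'M[R]_(n, m))
    (v : 'rV[R]_m) : 'rV[R]_m :=
  v *m proj_mx (kermx J^T) <<J>>%MS.

(** * Smooth maps *)

(** [U] is meant to be open and [V] finite dimensional.  Asking for continuity
    of all iterated directional derivatives is then the usual notion of class
    C^k on [U]. *)
Fixpoint Ck_on (R : realType) (V W : normedModType R) (k : nat) (U : set V)
    (f : V -> W) : Prop :=
  match k with
  | 0%N => forall x, U x -> {for x, continuous f}
  | k'.+1 => (forall x, U x -> {for x, continuous f}) /\
      forall v : V, (forall x, U x -> derivable f x v) /\ Ck_on k' U ('D_v f)
  end.

Definition smooth_on (R : realType) (V W : normedModType R) (U : set V)
    (f : V -> W) : Prop :=
  forall k : nat, Ck_on k U f.

(** * Smooth manifolds without boundary *)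

(** [chart_map] is a homeomorphism from the open set [chart_dom] of [M] onto
    the open set [chart_cod] of R^n, with inverse [chart_param].  Both
    functions are total; only their values on these two sets matter. *)
Record chart (R : realType) (M : topologicalType) (n : nat) : Type := Chart {
  chart_dom : set M;
  chart_cod : set 'rV[R]_n;
  chart_map : M -> 'rV[R]_n;
  chart_param : 'rV[R]_n -> M;
  chart_dom_open : open chart_dom;
  chart_cod_open : open chart_cod;
  chart_mapP : forall p, chart_dom p -> chart_cod (chart_map p);
  chart_paramP : forall x, chart_cod x -> chart_dom (chart_param x);
  chart_mapK : forall p, chart_dom p -> chart_param (chart_map p) = p;
  chart_paramK : forall x, chart_cod x -> chart_map (chart_param x) = x;
  chart_map_continuous : forall p, chart_dom p -> {for p, continuous chart_map};
  chart_param_continuous :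
    forall x, chart_cod x -> {for x, continuous chart_param}
}.

Definition smooth_atlas (R : realType) (M : topologicalType) (n : nat)
    (A : set (chart R M n)) : Prop :=
  (forall p : M, exists2 c, A c & chart_dom c p) /\
  (forall c d, A c -> A d ->
     smooth_on (chart_cod c `&` chart_param c @^-1` chart_dom d)
               (chart_map d \o chart_param c)).

Definition smooth_manifold (R : realType) (M : topologicalType) (n : nat)
    (A : set (chart R M n)) : Prop :=
  [/\ hausdorff_space M, @second_countable M & smooth_atlas A].

(** * Immersed submanifolds of R^m *)

(** [X] read in the chart [c].  The rows of its Jacobian at [x] are its partial
    derivatives, so the row space of ['J (local_rep c X) x] is the tangent
    space of the submanifold at [X (chart_param c x)]. *)
Definition local_rep (R : realType) (M : topologicalType) (n m : nat)
    (c : chart R M n) (X : M -> 'rV[R]_m) : 'rV[R]_n -> 'rV[R]_m :=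
  X \o chart_param c.

Definition immersion (R : realType) (M : topologicalType) (n m : nat)
    (A : set (chart R M n)) (X : M -> 'rV[R]_m) : Prop :=
  forall c, A c ->
    smooth_on (chart_cod c) (local_rep c X) /\
    forall x, chart_cod c x -> row_free ('J (local_rep c X) x).

Definition proper_map (S T : topologicalType) (f : S -> T) : Prop :=
  forall K : set T, compact K -> compact (f @^-1` K).

(** The vector field of R^m along the submanifold whose coordinates in the
    chart are [e]. *)
Definition pushforward (R : realType) (n m : nat)
    (f : 'rV[R]_n -> 'rV[R]_m) (e : 'rV[R]_n -> 'rV[R]_n) :
    'rV[R]_n -> 'rV[R]_m :=
  fun x => 'd f x (e x).

Definition orthonormal_frame (R : realType) (n m : nat)
    (f : 'rV[R]_n -> 'rV[R]_m) (W : set 'rV[R]_n)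
    (e : 'I_n -> 'rV[R]_n -> 'rV[R]_n) : Prop :=
  (forall i, smooth_on W (e i)) /\
  (forall x i j, W x ->
     dot (pushforward f (e i) x) (pushforward f (e j) x) = (i == j)%:R).

(** [H = \sum_i (nabla_{E_i} E_i)^N] at [p], where [E_i := pushforward f (e i)]
    and the Euclidean derivative of [E_i] in the direction [E_i] is computed in
    the chart as ['D_(e i x) E_i].  Local orthonormal frames exist
    (Gram-Schmidt) and the sum depends neither on the frame nor on the chart,
    so exactly one [H] satisfies this at each [p]. *)
Definition is_mean_curvature (R : realType) (M : topologicalType) (n m : nat)
    (A : set (chart R M n)) (X : M -> 'rV[R]_m) (p : M) (H : 'rV[R]_m) :
    Prop :=
  exists (c : chart R M n) (W : set 'rV[R]_n)
         (e : 'I_n -> 'rV[R]_n -> 'rV[R]_n),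
    let f := local_rep c X in
    let x := chart_map c p in
    [/\ A c /\ chart_dom c p,
        [/\ open W, W x & W `<=` chart_cod c],
        orthonormal_frame f W e &
        H = \sum_(i < n)
              normal_part ('J f x) ('D_(e i x) (pushforward f (e i)) x)].

(** As for the mean curvature, the normal component does not depend on the
    chart. *)
Definition is_normal_component (R : realType) (M : topologicalType) (n m : nat)
    (A : set (chart R M n)) (X : M -> 'rV[R]_m) (p : M) (v vN : 'rV[R]_m) :
    Prop :=
  forall c, A c -> chart_dom c p ->
    vN = normal_part ('J (local_rep c X) (chart_map c p)) v.

Definition self_shrinker (R : realType) (M : topologicalType) (n m : nat)
    (A : set (chart R M n)) (X : M -> 'rV[R]_m) : Prop :=
  forall p : M, exists H XN : 'rV[R]_m,
    [/\ is_mean_curvature A X p H,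
        is_normal_component A X p (X p) XN &
        H = - (2^-1 *: XN)].

(** * Completeness of the induced metric *)

Definition smooth_curve (R : realType) (M : topologicalType) (n : nat)
    (A : set (chart R M n)) (g : R -> M) : Prop :=
  continuous g /\
  forall c, A c ->
    @smooth_on R R^o 'rV[R]_n (g @^-1` chart_dom c) (chart_map c \o g).

Definition curve_length (R : realType) (M : topologicalType) (m : nat)
    (X : M -> 'rV[R]_m) (g : R -> M) : \bar R :=
  (\int[lebesgue_measure]_(t in `[0%R, 1%R]) (enorm (derive1 (X \o g) t))%:E)%E.

(** Riemannian distance; it is [+oo] between distinct components.  The curves
    may have vanishing velocity, so that every piecewise smooth curve has a
    smooth reparametrization and the infimum is the usual one. *)
Definition intrinsic_dist (R : realType) (M : topologicalType) (n m : nat)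
    (A : set (chart R M n)) (X : M -> 'rV[R]_m) (p q : M) : \bar R :=
  ereal_inf [set curve_length X g |
    g in [set g | [/\ smooth_curve A g, g 0 = p & g 1 = q]]].

(** The intrinsic distance induces the topology of [M], hence the limit can be
    taken in [M]. *)
Definition complete_submanifold (R : realType) (M : topologicalType)
    (n m : nat) (A : set (chart R M n)) (X : M -> 'rV[R]_m) : Prop :=
  forall u : nat -> M,
    (forall eps : R, 0 < eps -> exists N : nat, forall i j : nat,
       (N <= i)%N -> (N <= j)%N ->
       (intrinsic_dist A X (u i) (u j) < eps%:E)%E) ->
    exists p : M, u @ \oo --> p.

(** * Hyperplanes through the origin *)

Definition linear_hyperplane (R : realType) (m : nat) (P : set 'rV[R]_m) :
    Prop :=
  exists2 w : 'rV[R]_m, w != 0 & P = [set x | dot w x = 0].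

(** Replacing [w] by [- w] gives the other closed halfspace. *)
Definition closed_halfspace_of (R : realType) (m : nat)
    (P H : set 'rV[R]_m) : Prop :=
  exists w : 'rV[R]_m,
    [/\ w != 0, P = [set x | dot w x = 0] & H = [set x | 0 <= dot w x]].

(* Main.v *)
Require Import Defs.
From HB Require Import structures.
From mathcomp Require Import all_boot all_order all_algebra.
From mathcomp Require Import all_classical all_reals all_analysis.
From mathcomp Require Import ring lra.

Set Implicit Arguments.
Unset Strict Implicit.
Unset Printing Implicit Defensive.

Import Order.TTheory GRing.Theory Num.Theory.
Import numFieldNormedType.Exports.

Local Open Scope classical_set_scope.
Local Open Scope ring_scope.

(** Let [h = <w, X>], which is nonnegative along the submanifold, and let
    [L = Delta - <X, grad>/2] be the drift Laplacian.  The shrinker equation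
    gives [L X = - X/2], hence [L h = - h/2 <= 0] and
    [L |X|^2 = 2 n - |X|^2].  The argument is an elliptic maximum principle in
    two steps.

    Everything is computed with functions [phi \o X], where
    [phi y = <w, y> + F (|(y - Y) B|^2)] is defined on the ambient space (the
    records [radial]).  At a local minimum [grad phi] is normal, so the second
    derivatives of [phi \o X] along an orthonormal tangent frame [E_i] add up to
    [\sum_i D^2 phi (E_i, E_i) + <grad phi, H>], where
    [<grad phi, H> = - <grad phi, X>/2].  This sum is nonnegative:
    [shrinker_radial_max_principle].  No covariant derivative is involved, and
    only the tangent plane enters the result.

    Strong maximum principle ([zero_locus_nbhs]): the zero set of [h] is open.
    If [h] vanishes at [x0] and is positive at a point [y] close to [x0], then,
    for [s] the squared distance to [f y], measured after a linear map [B] that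
    makes the immersion [f] nearly isometric around [x0], the function
    [h - c exp (- a s)] has an interior minimum away from [y].  There
    [L exp (- a s) > 0] once [a] is large, and [L h <= 0], contrary to the
    inequality above.

    Global step ([height_eq0]): by the first step the set where [h > 0] is open
    and closed, so that its intersections with preimages of balls are compact.
    If it is not empty, [h + e |X|^2] attains its minimum over it by properness,
    and the inequality at the minimum reads [h + 2 e |X|^2 <= 4 e n].  The
    minimum thus lies in the fixed compact set [|X|^2 <= 2 n], where [h] has a
    positive lower bound, while [h <= 4 e n] there: impossible for small [e]. *)

(** * Euclidean product and sup norm *)

Section Dot.
Context {R : realType} {m : nat}.
Implicit Types u v w : 'rV[R]_m.

Lemma dotC u v : dot u v = dot v u.
Proof. by apply: eq_bigr => i _; rewrite mulrC. Qed.

Lemma dotDl u v w : dot (u + v) w = dot u w + dot v w.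
Proof. by rewrite -big_split; apply: eq_bigr => i _; rewrite mxE mulrDl. Qed.

Lemma dotDr u v w : dot w (u + v) = dot w u + dot w v.
Proof. by rewrite dotC dotDl !(dotC w). Qed.

Lemma dotZl (a : R) u v : dot (a *: u) v = a * dot u v.
Proof. by rewrite mulr_sumr; apply: eq_bigr => i _; rewrite mxE mulrA. Qed.

Lemma dotZr (a : R) u v : dot u (a *: v) = a * dot u v.
Proof. by rewrite dotC dotZl dotC. Qed.

Lemma dotNr u v : dot u (- v) = - dot u v.
Proof. by rewrite -scaleN1r dotZr mulN1r. Qed.

Lemma dotBr u v w : dot w (u - v) = dot w u - dot w v.
Proof. by rewrite dotDr dotNr. Qed.

Lemma dot0r u : dot u 0 = 0.
Proof. by rewrite -(scale0r 0) dotZr mul0r. Qed.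

Lemma dot_sumr (I : Type) (r : seq I) (F : I -> 'rV[R]_m) u :
  dot u (\sum_(i <- r) F i) = \sum_(i <- r) dot u (F i).
Proof.
elim: r => [|i r IH]; first by rewrite !big_nil dot0r.
by rewrite !big_cons dotDr IH.
Qed.

Lemma dotvv_ge0 u : 0 <= dot u u.
Proof. by apply: sumr_ge0 => i _; rewrite -expr2 sqr_ge0. Qed.

Lemma dotvv_eq0 u : dot u u = 0 -> u = 0.
Proof.
move/eqP; rewrite psumr_eq0; last by move=> i _; rewrite -expr2 sqr_ge0.
move=> /allP u0; apply/rowP => i; rewrite mxE.
by have := u0 i (mem_index_enum i); rewrite /= mulf_eq0 orbb => /eqP.
Qed.

Lemma dot_mulmx u v : u *m v^T = (dot u v)%:M.
Proof.
apply/matrixP => i j; rewrite !ord1 !mxE mulr1n.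
by apply: eq_bigr => k _; rewrite mxE.
Qed.

End Dot.

Lemma dot_mulmxr (R : realType) m k (B : 'M[R]_(k, m)) (u : 'rV[R]_m)
    (v : 'rV[R]_k) :
  dot u (v *m B) = dot (u *m B^T) v.
Proof.
have : (dot u (v *m B))%:M = (dot (u *m B^T) v)%:M :> 'M[R]_1.
  by rewrite -!dot_mulmx trmx_mul mulmxA.
by move=> /matrixP /(_ 0 0); rewrite !mxE !mulr1n.
Qed.

Section SupNorm.
Context {R : realType}.

Lemma mx_entry_norm_le m n (v : 'M[R]_(m, n)) i j : `|v i j| <= `|v|.
Proof.
rewrite [leRHS]/Num.Def.normr/= mx_normrE.
exact: (le_bigmax _ (fun ij => `|v ij.1 ij.2|) (i, j)).
Qed.

Lemma mx_norm_le m n (v : 'M[R]_(m, n)) (c : R) :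
  0 <= c -> (forall i j, `|v i j| <= c) -> `|v| <= c.
Proof.
move=> c0 vc; rewrite [leLHS]/Num.Def.normr/= mx_normrE.
by apply: bigmax_le => // -[i j] _; exact: vc.
Qed.

Lemma norm_dot_le n (u v : 'rV[R]_n) : `|dot u v| <= n%:R * (`|u| * `|v|).
Proof.
apply: (le_trans (ler_norm_sum _ _ _)).
have -> : n%:R * (`|u| * `|v|) = \sum_(i < n) `|u| * `|v|.
  by rewrite sumr_const card_ord mulr_natl.
by apply: ler_sum => i _; rewrite normrM ler_pM// mx_entry_norm_le.
Qed.

Lemma sqr_norm_le_dot n (v : 'rV[R]_n) : `|v| ^+ 2 <= dot v v.
Proof.
have d0 := dotvv_ge0 v.
rewrite -[leRHS]sqr_sqrtr// ler_sqr ?nnegrE ?sqrtr_ge0//.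
apply: mx_norm_le; first exact: sqrtr_ge0.
move=> i j; rewrite ord1 -ler_sqr ?nnegrE ?sqrtr_ge0// sqr_sqrtr//.
rewrite real_normK ?num_real// /dot (bigD1 j)//= -expr2 lerDl.
by apply: sumr_ge0 => k _; rewrite -expr2 sqr_ge0.
Qed.

Lemma mulmx_norm_le m n (v : 'rV[R]_m) (B : 'M[R]_(m, n)) :
  `|v *m B| <= m%:R * `|B| * `|v|.
Proof.
apply: mx_norm_le => [|i j]; first by rewrite !mulr_ge0.
rewrite mxE; apply: (le_trans (ler_norm_sum _ _ _)).
have -> : m%:R * `|B| * `|v| = \sum_(i < m) `|v| * `|B|.
  by rewrite sumr_const card_ord -mulrA (mulrC `|B|) mulr_natl.
by apply: ler_sum => k _; rewrite normrM ler_pM// mx_entry_norm_le.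
Qed.

Lemma continuous_mulmxr m n (B : 'M[R]_(m, n)) :
  continuous (fun v : 'rV[R]_m => v *m B).
Proof.
move=> v; apply/(@cvgrPdist_lt _ _ _ _ (nbhs_filter v)) => e e0.
have K0 : 0 < m%:R * `|B| + 1 by rewrite ltr_wpDl// mulr_ge0.
have : \forall u \near v, `|v - u| < e / (m%:R * `|B| + 1).
  by apply: (@cvgr_dist_lt _ _ _ _ (nbhs_filter v)) => //; rewrite divr_gt0.
apply: filterS => u vu; rewrite /= -mulmxBl.
rewrite (le_lt_trans (mulmx_norm_le _ _))//.
rewrite (@le_lt_trans _ _ ((m%:R * `|B| + 1) * `|v - u|))//.
  by rewrite ler_wpM2r// lerDl.
by rewrite mulrC -ltr_pdivlMr.
Qed.

Lemma continuous_dot (T : topologicalType) n (a b : T -> 'rV[R]_n) x :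
  {for x, continuous a} -> {for x, continuous b} ->
  {for x, continuous (fun y => dot (a y) (b y))}.
Proof.
move=> ca cb.
have := @cvg_big R 'I_n +%R 0 predT (@add_continuous R) T (nbhs x)
  (index_enum 'I_n) (fun i y => a y 0 i * b y 0 i)
  (fun i => a x 0 i * b x 0 i) (nbhs_filter x).
apply.
move=> i _; apply: cvgM.
  exact: (cvg_comp a (fun v : 'rV[R]_n => v 0 i) ca (@coord_continuous R 1 n 0 i (a x))).
exact: (cvg_comp b (fun v : 'rV[R]_n => v 0 i) cb (@coord_continuous R 1 n 0 i (b x))).
Qed.

End SupNorm.

(** * Strict differentiability of functions of class C^1 *)

Section Line.
Context {R : realType}.

(** Directional derivatives are derivatives along lines, so that the calculus
    of one real variable applies to them. *)
Lemma is_derive_line (V W : normedModType R) (f : V -> W) (x v : V) (s : R)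
    (df : W) :
  is_derive (s *: v + x) v f df ->
  is_derive s 1 (fun h : R => f (h *: v + x)) df.
Proof.
have E : (fun h : R => h^-1 *: (((fun k : R => f (k *: v + x)) \o shift s)
             (h *: (1 : R)) - f (s *: v + x)))
  = (fun h : R => h^-1 *: ((f \o shift (s *: v + x)) (h *: v)
                           - f (s *: v + x))).
  by apply/funext => h /=; rewrite [h *: 1]mulr1 scalerDl addrA.
move=> [cf vf]; split; first by rewrite /derivable E.
by rewrite /derive E.
Qed.

Lemma is_derive_line0 (V W : normedModType R) (f : V -> W) (x v : V)
    (df : W) :
  is_derive (0 : R) 1 (fun h : R => f (h *: v + x)) df -> is_derive x v f df.
Proof.
have E : (fun h : R => h^-1 *: (((fun k : R => f (k *: v + x)) \o shift (0:R))
             (h *: (1 : R)) - f ((0 : R) *: v + x)))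
  = (fun h : R => h^-1 *: ((f \o shift x) (h *: v) - f x)).
  by apply/funext => h /=; rewrite [h *: 1]mulr1 addr0 scale0r add0r.
by rewrite /derive /derivable => -[]; rewrite /derive /derivable E.
Qed.

Lemma mean_value_dir (V : normedModType R) (g : V -> R) (z v : V) (L e t : R) :
  (forall s, 0 <= s <= 1 -> derivable g ((s * t) *: v + z) v /\
     `|'D_v g ((s * t) *: v + z) - L| <= e) ->
  `|g (t *: v + z) - g z - t * L| <= e * `|t|.
Proof.
move=> gd; have [->|t0] := eqVneq t 0.
  by rewrite scale0r add0r subrr mul0r subr0 normr0 mulr0.
pose G s := g (s *: v + z).
have Gd s : Num.min 0 t <= s <= Num.max 0 t ->
  is_derive s 1 G ('D_v g (s *: v + z)) /\ `|'D_v g (s *: v + z) - L| <= e.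
  move=> st; have [|] := gd (s / t).
    move: st; have [tp|tn] := leP 0 t => /andP[s1 s2].
      have tp' : 0 < t by rewrite lt_def t0.
      by rewrite ler_pdivlMr// ler_pdivrMr// mul0r mul1r s1.
    by rewrite ler_ndivlMr// ler_ndivrMr// mul0r mul1r s1 s2.
  rewrite divfK// => dg gL; split => //; apply: is_derive_line.
  exact: derivableP.
have Gc : {within `[Num.min 0 t, Num.max 0 t], continuous G}.
  apply: derivable_within_continuous => s; rewrite in_itv/= => /Gd[+ _].
  by case.
have mM : Num.min 0 t <= Num.max 0 t by rewrite ge_min !le_max lexx.
have [|c cI Gce] := MVT_segment mM _ Gc (df := fun s => 'D_v g (s *: v + z)).
  by move=> s /subset_itv_oo_cc; rewrite in_itv/= => /Gd[].
have [_ cL] := Gd c cI.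
have -> : g (t *: v + z) - g z - t * L = ('D_v g (c *: v + z) - L) * t.
  rewrite mulrBl (mulrC L); congr (_ - _).
  move: Gce; rewrite /G; have [tp|tn] := leP 0 t.
    by rewrite scale0r add0r subr0.
  by rewrite scale0r add0r sub0r mulrN => E; rewrite -[RHS]opprK -E opprB.
by rewrite normrM ler_wpM2r.
Qed.

End Line.

Lemma differentiable_epsP (R : realType) (V W : normedModType R) (f : V -> W)
    (L : {linear V -> W}) (x : V) : continuous L ->
  (forall e : R, 0 < e -> exists2 d : R, 0 < d &
     forall h, `|h| < d -> `|f (h + x) - f x - L h| <= e * `|h|) ->
  differentiable f x /\ 'd f x = L :> (V -> W).
Proof.
move=> Lc fL.
have E : f \o shift x = cst (f x) + L +o_ 0 id.
  apply/eqaddoP => e e0; have [d d0 fd] := fL e e0.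
  apply/nbhs_ballP; exists d => //= h; rewrite -ball_normE/= sub0r normrN => hd.
  by have := fd h hd; rewrite -addrA -opprD.
have dE := diff_unique Lc E.
by split => //; apply/diff_locallyP; rewrite dE.
Qed.

Section StrictDifferentiability.
Context {R : realType} {n m : nat}.
Implicit Types (f : 'rV[R]_n -> 'rV[R]_m) (U : set 'rV[R]_n).

Definition partials f (x : 'rV[R]_n) : 'M[R]_(n, m) :=
  \matrix_k 'D_(delta_mx 0 k) f x.

(** The linearity of [v |-> 'D_v f x] follows from these conditions, by
    [C1_at_diff]. *)
Definition C1_at f (x : 'rV[R]_n) : Prop :=
  forall k : 'I_n, (\forall y \near x, derivable f y (delta_mx 0 k)) /\
    {for x, continuous ('D_(delta_mx 0 k) f)}.

(** One coordinate is changed at a time: each step is controlled by the mean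
    value theorem and the continuity of one partial derivative, and the
    intermediate points stay in the ball because it is one of the sup norm. *)
Lemma C1_at_strict f (x : 'rV[R]_n) (e : R) : C1_at f x -> 0 < e ->
  exists2 d : R, 0 < d & forall y z, `|x - y| < d -> `|x - z| < d ->
    `|f y - f z - (y - z) *m partials f x| <= e * `|y - z|.
Proof.
move=> fx e0.
(* [n.+1] rather than [n], which may be zero. *)
pose e' := e / n.+1%:R.
have e'0 : 0 < e' by rewrite divr_gt0.
have : \forall y \near x, forall k : 'I_n, derivable f y (delta_mx 0 k) /\
    `|'D_(delta_mx 0 k) f y - 'D_(delta_mx 0 k) f x| < e'.
  apply: (@filter_forall _ _ (fun (k : 'I_n) y => derivable f y (delta_mx 0 k) /\
    `|'D_(delta_mx 0 k) f y - 'D_(delta_mx 0 k) f x| < e') _ (nbhs_filter x)) => k.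
  have [fk ck] := fx k.
  have ck' := @cvgr_distC_lt _ _ _ _ (nbhs_filter x) _ _ ck _ e'0.
  by apply: filterS2 fk ck' => y; split.
move=> /nbhs_ballP[d /= d0 xd]; exists d => // y z xy xz.
pose hyb (k : nat) : 'rV[R]_n := \row_i (if (i < k)%N then y 0 i else z 0 i).
have hyb0 : hyb 0%N = z by apply/rowP => i; rewrite mxE.
have hybn : hyb n = y by apply/rowP => i; rewrite mxE ltn_ord.
pose t (k : 'I_n) := y 0 k - z 0 k.
have hybS (k : 'I_n) : hyb k.+1 = t k *: delta_mx 0 k + hyb k.
  apply/rowP => i; rewrite !mxE eqxx/= /t ltnS leq_eqVlt.
  have [->|ik] := eqVneq i k.
    by rewrite eqxx ltnn/= mulr1 subrK.
  by rewrite -val_eqE in ik; rewrite (negbTE ik)/= mulr0 add0r.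
have hyb_ball (k : 'I_n) s : 0 <= s <= 1 ->
    ball x d ((s * t k) *: delta_mx 0 k + hyb k).
  move=> /andP[s0 s1]; rewrite -ball_normE/=.
  rewrite (@le_lt_trans _ _ (Num.max `|x - y| `|x - z|))//; last first.
    by rewrite gt_max xy xz.
  apply: mx_norm_le => [|i j]; first by rewrite le_max normr_ge0.
  rewrite ord1 {i} !mxE eqxx/=.
  have xyj : `|x 0 j - y 0 j| <= Num.max `|x - y| `|x - z|.
    have := mx_entry_norm_le (x - y) 0 j; rewrite !mxE => H.
    by rewrite le_max H.
  have xzj : `|x 0 j - z 0 j| <= Num.max `|x - y| `|x - z|.
    have := mx_entry_norm_le (x - z) 0 j; rewrite !mxE => H.
    by rewrite le_max H orbT.
  case: (eqVneq j k) xyj xzj => [->|jk] xyj xzj; last first.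
    by rewrite mulr0 add0r; case: ifP.
  rewrite ltnn mulr1 /t.
  have -> : x 0 k - (s * (y 0 k - z 0 k) + z 0 k) =
    s * (x 0 k - y 0 k) + (1 - s) * (x 0 k - z 0 k) by ring.
  apply: (le_trans (ler_normD _ _)); rewrite !normrM.
  rewrite (ger0_norm s0) (ger0_norm (_ : 0 <= 1 - s)) ?subr_ge0//.
  set M := Num.max _ _ in xyj xzj *.
  have -> : M = s * M + (1 - s) * M by ring.
  by apply: lerD; rewrite ler_wpM2l ?subr_ge0.
have step (k : 'I_n) :
    `|f (hyb k.+1) - f (hyb k) - t k *: 'D_(delta_mx 0 k) f x|
    <= e' * `|y - z|.
  apply: mx_norm_le => [|i j]; first by rewrite mulr_ge0// ltW.
  rewrite ord1 {i} !mxE hybS.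
  apply: (le_trans (mean_value_dir (g := fun y => f y 0 j) (e := e') _)).
    move=> s /(hyb_ball k) /xd /(_ k)[dk ek].
    split; first by have /derivable_mxP := dk; apply.
    have -> : 'D_(delta_mx 0 k) (fun y0 : 'rV_n => f y0 0 j)
        ((s * t k) *: delta_mx 0 k + hyb k) =
        ('D_(delta_mx 0 k) f ((s * t k) *: delta_mx 0 k + hyb k)) 0 j.
      by rewrite derive_mx// mxE.
    have := mx_entry_norm_le ('D_(delta_mx 0 k) f
      ((s * t k) *: delta_mx 0 k + hyb k) - 'D_(delta_mx 0 k) f x) 0 j.
    by rewrite !mxE => /le_trans; apply; exact: ltW.
  rewrite ler_pM2l//.
  by have := mx_entry_norm_le (y - z) 0 k; rewrite !mxE.
have -> : f y - f z - (y - z) *m partials f x = \sum_(k < n)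
    (f (hyb k.+1) - f (hyb k) - t k *: 'D_(delta_mx 0 k) f x).
  rewrite sumrB -(big_mkord predT (fun k => f (hyb k.+1) - f (hyb k))).
  rewrite telescope_sumr// hyb0 hybn; congr (_ - _).
  apply/rowP => j; rewrite mxE summxE; apply: eq_bigr => k _.
  by rewrite !mxE.
apply: (le_trans (ler_norm_sum _ _ _)).
apply: (@le_trans _ _ (\sum_(k < n) e' * `|y - z|)).
  by apply: ler_sum => k _; exact: step.
rewrite sumr_const card_ord -mulrnAl ler_wpM2r// /e' -mulr_natr.
by rewrite -mulrA ler_piMr ?(ltW e0)// ler_pdivrMl// mulr1 ler_nat.
Qed.

Lemma C1_at_diff f x : C1_at f x ->
  differentiable f x /\ forall v, 'd f x v = v *m partials f x.
Proof.
move=> fx; pose L : {linear 'rV[R]_n -> 'rV[R]_m} := mulmxr (partials f x).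
have Lc : continuous L by exact: continuous_mulmxr.
have [|df dE] := @differentiable_epsP _ _ _ f L x Lc; last first.
  by split => // v; rewrite dE.
move=> e e0; have [d d0 fd] := C1_at_strict fx e0; exists d => // h hd.
have := fd (h + x) x; rewrite subrr normr0 d0 addrK.
by rewrite opprD addrCA subrr addr0 normrN; apply.
Qed.

(** The two bounds say that [f] differs from ['d f x] by a map of Lipschitz
    constant [e] near [x]. *)
Lemma C1_at_strict_diff f (x : 'rV[R]_n) (e : R) :
  (\forall y \near x, C1_at f y) -> 0 < e ->
  exists2 d : R, 0 < d & forall y, `|x - y| < d ->
   (forall z, `|x - z| < d -> `|f y - f z - 'd f x (y - z)| <= e * `|y - z|) /\
   (forall v, `|'d f y v - 'd f x v| <= e * `|v|).
Proof.
move=> fU e0; have fx := nbhs_singleton fU.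
have [d d0 fd] := C1_at_strict fx e0.
pose e' := e / n.+1%:R.
have e'0 : 0 < e' by rewrite divr_gt0.
have : \forall y \near x, forall k : 'I_n,
    `|'D_(delta_mx 0 k) f y - 'D_(delta_mx 0 k) f x| < e'.
  apply: (@filter_forall _ _ (fun (k : 'I_n) y =>
    `|'D_(delta_mx 0 k) f y - 'D_(delta_mx 0 k) f x| < e') _ (nbhs_filter x)) => k.
  have [_ ck] := fx k.
  exact: (@cvgr_distC_lt _ _ _ _ (nbhs_filter x) _ _ ck).
move=> /(filterI fU) /nbhs_ballP[d' /= d'0 xd'].
exists (Num.min d d'); first by rewrite lt_min d0.
move=> y; rewrite lt_min => /andP[yd yd']; split => [z|v].
  by rewrite lt_min => /andP[zd _]; rewrite (C1_at_diff fx).2; exact: fd.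
have [fy dk] : (C1_at f `&` (fun y => forall k : 'I_n,
    `|'D_(delta_mx 0 k) f y - 'D_(delta_mx 0 k) f x| < e')) y.
  by apply: xd'; rewrite -ball_normE.
have -> : 'd f y v - 'd f x v = v *m (partials f y - partials f x).
  by rewrite mulmxBr; congr (_ - _); [exact: (C1_at_diff fy).2 |
                                      exact: (C1_at_diff fx).2].
have -> : v *m (partials f y - partials f x) =
  \sum_(k < n) v 0 k *: ('D_(delta_mx 0 k) f y - 'D_(delta_mx 0 k) f x).
  apply/rowP => j; rewrite mxE summxE; apply: eq_bigr => k _.
  by rewrite !mxE.
apply: (le_trans (ler_norm_sum _ _ _)).
apply: (@le_trans _ _ (\sum_(k < n) e' * `|v|)).
  apply: ler_sum => k _; rewrite normrZ mulrC ler_pM//; first exact: ltW.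
  exact: mx_entry_norm_le.
rewrite sumr_const card_ord -mulrnAl ler_wpM2r// /e' -mulr_natr.
by rewrite -mulrA ler_piMr ?(ltW e0)// ler_pdivrMl// mulr1 ler_nat.
Qed.

Lemma Ck_on1_C1_at U f (x : 'rV[R]_n) : nbhs x U -> Ck_on 1 U f ->
  \forall y \near x, C1_at f y.
Proof.
move=> /nbhs_interior xU [_ fU]; apply: filterS xU => y yU k.
have [dk ck] := fU (delta_mx 0 k); split; last first.
  by apply: ck; exact: (nbhs_singleton yU).
by apply: filterS yU => z; exact: dk.
Qed.

End StrictDifferentiability.

(** * Directional derivatives *)

Section DirectionalDerivatives.
Context {R : realType} {V : normedModType R}.
Implicit Types (x v : V).

Lemma is_derive_rowP n (f : V -> 'rV[R]_n) x v (df : 'rV[R]_n) :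
  is_derive x v f df <->
  forall j, is_derive x v (fun y => f y 0 j) (df 0 j).
Proof.
split=> [[fx <-] j|fj].
  split; first by have /derivable_mxP := fx; apply.
  by rewrite derive_mx// mxE.
have fx : derivable f x v.
  by apply/derivable_mxP => i j; rewrite ord1; have [] := fj j.
split => //; rewrite derive_mx//; apply/rowP => j; rewrite mxE.
by have [] := fj j.
Qed.

Lemma is_derive_sum_fct n (h : 'I_n -> V -> R) x v (dh : 'I_n -> R) :
  (forall i, is_derive x v (h i) (dh i)) ->
  is_derive x v (fun y => \sum_(i < n) h i y) (\sum_(i < n) dh i).
Proof.
move=> hd; rewrite (_ : (fun y => _) = \sum_(i < n) h i).
  exact: is_derive_sum.
by apply/funext => y; rewrite fct_sumE.
Qed.

Lemma is_derive_dot n (a b : V -> 'rV[R]_n) x v (da db : 'rV[R]_n) :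
  is_derive x v a da -> is_derive x v b db ->
  is_derive x v (fun y => dot (a y) (b y)) (dot da (b x) + dot (a x) db).
Proof.
move=> /is_derive_rowP ha /is_derive_rowP hb.
rewrite /dot -big_split /=; apply: is_derive_sum_fct => i.
apply: (is_derive_eq (is_deriveM (ha i) (hb i))).
by rewrite /GRing.scale/= addrC (mulrC (b x 0 i)).
Qed.

Lemma is_derive_mulmxr n k (f : V -> 'rV[R]_n) (B : 'M[R]_(n, k)) x v
    (df : 'rV[R]_n) :
  is_derive x v f df -> is_derive x v (fun y => f y *m B) (df *m B).
Proof.
move=> fd; apply/is_derive_rowP => j.
rewrite (_ : (fun y => _) = (fun y => dot (f y) (row j B^T))); last first.
  by apply/funext => y; rewrite mxE; apply: eq_bigr => i _; rewrite !mxE.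
apply: (is_derive_eq (is_derive_dot fd (is_derive_cst (row j B^T) x v))).
by rewrite dot0r addr0 mxE; apply: eq_bigr => i _; rewrite !mxE.
Qed.

Lemma is_derive_chain (F : R -> R) (q : V -> R) x v (a b : R) :
  is_derive (q x) 1 F a -> is_derive x v q b ->
  is_derive x v (F \o q) (a * b).
Proof.
move=> Fd qd; apply: is_derive_line0.
apply: (@is_derive1_comp R F (fun h => q (h *: v + x))).
  by rewrite scale0r add0r.
by apply: is_derive_line; rewrite scale0r add0r.
Qed.

(** If [u''] were negative at a critical point, [u'] would be negative just
    after it, and the mean value theorem would give smaller values of [u]. *)
Lemma second_derivative_test (u u1 : V -> R) x v (l : R) :
  (\forall y \near x, is_derive y v u (u1 y)) -> is_derive x v u1 l ->
  (\forall y \near x, u x <= u y) -> u1 x = 0 /\ 0 <= l.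
Proof.
move=> ud u1d umin.
pose g (t : R) := u (t *: v + x); pose g1 (t : R) := u1 (t *: v + x).
have cl : (fun t : R => t *: v + x) t @[t --> 0] --> x.
  rewrite -[X in _ --> X]add0r -(scale0r v).
  by apply: cvgD; [apply: cvgZr_tmp; exact: cvg_id | exact: cvg_cst].
have : \forall t \near (0 : R), is_derive (t : R) 1 g (g1 t) /\ g 0 <= g t.
  have H : \forall t \near (0 : R), is_derive (t *: v + x) v u (u1 (t *: v + x))
    /\ u x <= u (t *: v + x) := cl _ (@filterI _ _ (nbhs_filter x) _ _ ud umin).
  apply: filterS H => t [dt mt].
  by split; [exact: is_derive_line | rewrite /g scale0r add0r].
move=> /nbhs_ballP[d /= d0 gd].
have gd' (t : R) : `|t| < d -> is_derive (t : R) 1 g (g1 t) /\ g 0 <= g t.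
  by move=> td; apply: gd; rewrite /ball/= sub0r normrN.
have g10 : g1 0 = u1 x by rewrite /g1 scale0r add0r.
have u1x : u1 x = 0.
  have g0 : is_derive (0 : R) 1 g 0.
    apply: (@derive1_at_min _ g (- d) d 0).
    - by move: d0; lra.
    - by move=> t; rewrite in_itv/= -ltr_norml => /gd'[[]].
    - by rewrite in_itv/= d0 oppr_lt0 d0.
    - by move=> t; rewrite in_itv/= -ltr_norml => /gd'[].
  have [[_ <-] _] : is_derive (0 : R) 1 g (u1 x) /\ g 0 <= g 0.
    by rewrite -g10; apply: gd'; rewrite normr0.
  by have [] := g0.
split => //; rewrite leNgt; apply/negP => l0.
have [g1c g1l] : is_derive (0 : R) 1 g1 l.
  by apply: is_derive_line; rewrite scale0r add0r.
have : h^-1 *: (g1 (h *: 1 + 0) - g1 0) @[h --> 0^'] --> l.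
  by rewrite -g1l; exact: g1c.
move=> /cvgrPdist_lt /(_ (- l)); rewrite oppr_gt0 => /(_ l0).
move=> [r /= r0 rl].
pose t := Num.min d r / 2.
have t0 : 0 < t by rewrite divr_gt0// lt_min d0.
have tdr : t < Num.min d r by rewrite ltr_pdivrMr// mulr_natr mulr2n ltrDl lt_min d0.
have /andP[td tr] : (t < d) && (t < r) by rewrite -lt_min.
have gc : {within `[0, t], continuous g}.
  apply: derivable_within_continuous => s; rewrite in_itv/= => /andP[s0 st].
  have sd : `|s| < d by rewrite ger0_norm// (le_lt_trans st).
  by have [[]] := gd' s sd.
have [|c] := MVT t0 (f := g) (df := g1) _ gc.
  move=> s; rewrite in_itv/= => /andP[s0 st].
  have sd : `|s| < d by rewrite ger0_norm ?(ltW s0)// (lt_trans st).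
  by have [] := gd' s sd.
rewrite in_itv/= => /andP[c0 ct] gtE.
have [|_ g0t] := gd' t; first by rewrite gtr0_norm.
have : 0 <= g1 c.
  move: g0t; rewrite -subr_ge0 gtE subr0 pmulr_lge0//.
have := rl c; rewrite /ball/= sub0r normrN gtr0_norm// (lt_trans ct)//.
move=> /(_ isT); rewrite gt_eqF// => /(_ isT).
rewrite [c *: 1]mulr1 addr0 g10 u1x subr0 => cl'.
apply/negP; rewrite -ltNge.
move: cl'; rewrite ltr_norml => /andP[+ _].
rewrite opprK ltrBrDr -ltrBrDl subrr => gneg.
by move: gneg; rewrite /GRing.scale/= pmulr_rlt0// invr_gt0.
Qed.

End DirectionalDerivatives.

(** * Normal projections and orthonormal frames *)

Section NormalPart.
Context {R : realType}.

Lemma capmx_kermx_tr n m (J : 'M[R]_(n, m)) : (kermx J^T :&: <<J>> = 0)%MS.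
Proof.
apply/eqP/rowV0P => z; rewrite sub_capmx => /andP[/sub_kermxP zJ].
rewrite genmxE => /submxP[u zu]; apply: dotvv_eq0.
by rewrite {2}zu dot_mulmxr zJ dotC dot0r.
Qed.

(** The tangential part of [v] is a combination of the rows of [J], to which
    [a] is orthogonal. *)
Lemma dot_normal_part n m (J : 'M[R]_(n, m)) (a v : 'rV[R]_m) :
  (forall u, dot a (u *m J) = 0) -> dot a (normal_part J v) = dot a v.
Proof.
move=> aJ; have J0 := capmx_kermx_tr J.
have vKJ : (v <= kermx J^T + <<J>>)%MS.
  apply: submx_full; rewrite -col_leq_rank mxrank_disjoint_sum//.
  by rewrite mxrank_ker mxrank_tr genmxE subnK ?rank_leq_col.
have := proj_mx_sub <<J>>%MS (kermx J^T) v.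
rewrite genmxE => /submxP[u vu].
by rewrite -{2}(add_proj_mx J0 vKJ) dotDr vu aJ addr0.
Qed.

(** [e_i] is the coordinate expression of the orthonormal family [e_i *m J] of
    the row space of [J]; having as many members as [J] has rows, the family
    is a basis. *)
Lemma orthonormal_expansion n m (J : 'M[R]_(n, m)) (e : 'I_n -> 'rV[R]_n) :
  (forall i j, dot (e i *m J) (e j *m J) = (i == j)%:R) ->
  forall v, v *m J = \sum_i dot (v *m J) (e i *m J) *: (e i *m J).
Proof.
move=> ortho v; pose Me := \matrix_i e i; pose E := Me *m J.
have rowE i : row i E = e i *m J by rewrite row_mul rowK.
have E1 : Me *m (J *m E^T) = 1%:M.
  rewrite mulmxA; apply/matrixP => i j; rewrite !mxE -ortho.
  by apply: eq_bigr => k _; rewrite -!rowE !mxE.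
have {1}-> : v = v *m (J *m E^T) *m Me by rewrite -mulmxA (mulmx1C E1) mulmx1.
rewrite -mulmxA -/E; apply/rowP => j; rewrite mxE summxE.
apply: eq_bigr => i _; rewrite [RHS]mxE -rowE [row i E 0 j]mxE; congr (_ * _).
by rewrite mulmxA mxE; apply: eq_bigr => k _; rewrite !mxE.
Qed.

Lemma dot_expansion n m (E : 'I_n -> 'rV[R]_m) (u : 'rV[R]_m) :
  u = \sum_i dot u (E i) *: E i -> dot u u = \sum_i dot u (E i) ^+ 2.
Proof.
move=> uE; rewrite {2}uE dot_sumr; apply: eq_bigr => i _.
by rewrite dotZr expr2.
Qed.

End NormalPart.

(** * Radial test functions *)

(** A test function [y |-> <w, y> + F (|(y - Y) B|^2)] with [F] twice
    differentiable.  Paraboloids and Gaussians in suitable linear coordinates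
    are the only ones needed, and this common form gives a single computation
    of their second derivatives. *)
Record radial (R : realType) (m : nat) : Type := Radial {
  axis : 'rV[R]_m;
  proj_dim : nat;
  proj : 'M[R]_(m, proj_dim);
  pole : 'rV[R]_m;
  profile : R -> R;
  profile1 : R -> R;
  profile2 : R -> R;
  profile_d : forall s : R, is_derive s 1 profile (profile1 s);
  profile1_d : forall s : R, is_derive s 1 profile1 (profile2 s)
}.

Section Radial.
Context {R : realType} {m : nat}.
Implicit Types (phi : radial R m) (y v : 'rV[R]_m).

Definition offset phi y : 'rV[R]_(proj_dim phi) := (y - pole phi) *m proj phi.

Definition sqdist phi y : R := dot (offset phi y) (offset phi y).

Definition radial_fun phi y : R := dot (axis phi) y + profile phi (sqdist phi y).

Definition radial_grad phi y : 'rV[R]_m :=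
  axis phi +
  (2 * profile1 phi (sqdist phi y)) *: (offset phi y *m (proj phi)^T).

(** The quadratic form [D^2 phi (v, v)]. *)
Definition radial_hess phi y v : R :=
  4 * profile2 phi (sqdist phi y) * dot (offset phi y) (v *m proj phi) ^+ 2 +
  2 * profile1 phi (sqdist phi y) * dot (v *m proj phi) (v *m proj phi).

Lemma dot_radial_grad phi y v :
  dot (radial_grad phi y) v = dot (axis phi) v +
  2 * profile1 phi (sqdist phi y) * dot (offset phi y) (v *m proj phi).
Proof. by rewrite dotDl dotZl dot_mulmxr. Qed.

Section Chain.
Context {V : normedModType R}.
Implicit Types (f : V -> 'rV[R]_m) (x e : V).

Lemma is_derive_offset phi f x e df : is_derive x e f df ->
  is_derive x e (offset phi \o f) (df *m proj phi).
Proof.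
move=> fd; have cd : is_derive x e (fun z => f z - pole phi) df.
  by apply: (is_derive_eq (is_deriveB fd (is_derive_cst _ _ _))); rewrite subr0.
exact: (is_derive_mulmxr (proj phi) cd).
Qed.

Lemma is_derive_sqdist phi f x e df : is_derive x e f df ->
  is_derive x e (sqdist phi \o f) (2 * dot (offset phi (f x)) (df *m proj phi)).
Proof.
move=> /(is_derive_offset phi) od; apply: (is_derive_eq (is_derive_dot od od)).
by rewrite dotC mulr_natl mulr2n.
Qed.

Lemma is_derive_radial_fun phi f x e df : is_derive x e f df ->
  is_derive x e (radial_fun phi \o f) (dot (radial_grad phi (f x)) df).
Proof.
move=> fd; have sd := is_derive_sqdist phi fd.
have Fd := is_derive_chain (q := sqdist phi \o f)
  (profile_d phi (sqdist phi (f x))) sd.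
have wd := is_derive_dot (is_derive_cst (axis phi) x e) fd.
apply: (is_derive_eq (is_deriveD wd Fd)).
by rewrite dot_radial_grad dotC dot0r add0r mulrCA !mulrA.
Qed.

Lemma is_derive_radial_grad phi f (f1 : V -> 'rV[R]_m) x e df1 :
  is_derive x e f (f1 x) -> is_derive x e f1 df1 ->
  is_derive x e (fun z => dot (radial_grad phi (f z)) (f1 z))
    (radial_hess phi (f x) (f1 x) + dot (radial_grad phi (f x)) df1).
Proof.
move=> fd f1d; have sd := is_derive_sqdist phi fd.
have Fd := is_derive_chain (q := sqdist phi \o f)
  (profile1_d phi (sqdist phi (f x))) sd.
have wd := is_derive_dot (is_derive_cst (axis phi) x e) f1d.
have od := is_derive_dot (is_derive_offset phi fd)
  (is_derive_mulmxr (proj phi) f1d).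
have := is_deriveD wd (is_deriveM (is_deriveZ 2 Fd) od).
rewrite (_ : _ + _ = (fun z => dot (radial_grad phi (f z)) (f1 z))); last first.
  by apply/funext => z; rewrite dot_radial_grad.
move=> /is_derive_eq; apply.
rewrite dot_radial_grad /radial_hess /GRing.scale/= (dotC 0) dot0r.
set p1 := profile1 _ _; set p2 := profile2 _ _.
set c := dot _ (df1 *m _); set d := dot (offset _ _) (f1 x *m _).
set b := dot (f1 x *m _) _; set a := dot _ df1.
rewrite -[LHS]/(0 + a + (2 * p1 * (b + c) + d * (2 * (p2 * (2 * d))))).
by ring.
Qed.

End Chain.

End Radial.

(** * Second order condition along an orthonormal frame *)

Section FrameDerivative.
Context {R : realType} {n m : nat}.
Variables (f : 'rV[R]_n -> 'rV[R]_m) (x : 'rV[R]_n).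
Hypothesis fC1 : \forall y \near x, C1_at f y.
Hypothesis fC2 : forall k : 'I_n, C1_at ('D_(delta_mx 0 k) f) x.

Let hess_along v : 'M[R]_(n, m) :=
  \matrix_k 'D_v ('D_(delta_mx 0 k) f) x.

Lemma is_derive_dir (v : 'rV[R]_n) (y : 'rV[R]_n) :
  C1_at f y -> is_derive y v f ('d f y v).
Proof.
move=> fy; have [dfy _] := C1_at_diff fy.
by apply: DeriveDef; [exact: diff_derivable | rewrite deriveE].
Qed.

(** The derivative of [E = 'd f e] is tangential up to a second derivative of
    [f] that depends on [e] only through its value at [x]. *)
Lemma is_derive_pushforward (e : 'rV[R]_n -> 'rV[R]_n) v (de : 'rV[R]_n) :
  is_derive x v e de ->
  is_derive x v (Defs.pushforward f e) ('d f x de + e x *m hess_along v).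
Proof.
move=> ed.
apply: (@near_eq_is_derive _ _ _ (fun y => e y *m partials f y)).
  apply: filterS fC1 => y fy.
  by rewrite /Defs.pushforward; have [_ ->] := C1_at_diff fy.
apply/is_derive_rowP => j.
rewrite (_ : (fun y => _) = (fun y => \sum_(k < n) e y 0 k *
    ('D_(delta_mx 0 k) f y) 0 j)); last first.
  by apply/funext => y; rewrite mxE; apply: eq_bigr => k _; rewrite mxE.
have -> : ('d f x de + e x *m hess_along v) 0 j = \sum_(k < n)
    (e x 0 k * ('D_v ('D_(delta_mx 0 k) f) x) 0 j +
     ('D_(delta_mx 0 k) f x) 0 j * de 0 k).
  have [_ ->] := C1_at_diff (nbhs_singleton fC1).
  rewrite mxE addrC big_split /= !mxE; congr (_ + _).
    by apply: eq_bigr => k _; rewrite mxE.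
  by apply: eq_bigr => k _; rewrite mxE mulrC.
apply: is_derive_sum_fct => k.
have /is_derive_rowP ek := ed.
have [dk _] := C1_at_diff (fC2 k).
have /is_derive_rowP fk := derivableP (diff_derivable (v := v) dk).
exact: (is_derive_eq (is_deriveM (ek k) (fk j))).
Qed.

(** The second derivative of [phi \o f] along the straight line of direction
    [e i x] is nonnegative.  It involves the acceleration of the image of that
    line, which differs from the derivative of [E_i] along itself by a tangent
    vector only; at a local minimum the gradient is orthogonal to tangent
    vectors, so one may be replaced by the other. *)
Lemma radial_min_frame (phi : radial R m) (e : 'I_n -> 'rV[R]_n -> 'rV[R]_n) :
  (forall i v, derivable (e i) x v) ->
  (\forall y \near x, radial_fun phi (f x) <= radial_fun phi (f y)) ->
  (forall v, dot (radial_grad phi (f x)) ('d f x v) = 0) /\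
  forall i, 0 <= radial_hess phi (f x) ('d f x (e i x)) +
    dot (radial_grad phi (f x)) ('D_(e i x) (Defs.pushforward f (e i)) x).
Proof.
move=> ed fmin.
have test v := @second_derivative_test R _ (radial_fun phi \o f)
  (fun y => dot (radial_grad phi (f y)) ('d f y v)) x v.
have near_d v : \forall y \near x, is_derive y v (radial_fun phi \o f)
    (dot (radial_grad phi (f y)) ('d f y v)).
  by apply: filterS fC1 => y fy; apply/is_derive_radial_fun/is_derive_dir.
have d1 v : is_derive x v (fun y => 'd f y v) (v *m hess_along v).
  apply: (is_derive_eq (is_derive_pushforward (is_derive_cst v x v))).
  have [_ dE] := C1_at_diff (nbhs_singleton fC1).
  by rewrite (dE 0) mul0mx add0r.
have d2 v := is_derive_radial_grad phi (is_derive_dir v (nbhs_singleton fC1)) (d1 v).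
have crit v : dot (radial_grad phi (f x)) ('d f x v) = 0.
  by have [] := test v _ (near_d v) (d2 v) fmin.
split => // i.
have [_] := test (e i x) _ (near_d _) (d2 _) fmin.
have [_ ->] := is_derive_pushforward (derivableP (ed i (e i x))).
by rewrite dotDr crit add0r.
Qed.

End FrameDerivative.

(** * The maximum principle on a self-shrinker *)

Lemma smooth_on_C1_at (R : realType) (n m : nat) (U : set 'rV[R]_n)
    (f : 'rV[R]_n -> 'rV[R]_m) (x : 'rV[R]_n) :
  nbhs x U -> smooth_on U f ->
  (\forall y \near x, C1_at f y) /\
  forall k : 'I_n, C1_at ('D_(delta_mx 0 k) f) x.
Proof.
move=> xU fU; split; first exact: Ck_on1_C1_at xU (fU 1%N).
move=> k; have [_ f2] := fU 2%N; have [_ f2k] := f2 (delta_mx 0 k).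
exact: nbhs_singleton (Ck_on1_C1_at xU f2k).
Qed.

(** Only the differential of [f] at [x] occurs besides the minimum condition:
    the mean curvature has been eliminated by means of the shrinker equation,
    and the frame need not come from the chart in which [f] is read. *)
Definition radial_max_principle_at (R : realType) (n m : nat)
    (f : 'rV[R]_n -> 'rV[R]_m) (x : 'rV[R]_n) : Prop :=
  exists E : 'I_n -> 'rV[R]_m,
  [/\ forall i j, dot (E i) (E j) = (i == j)%:R,
      forall v, 'd f x v = \sum_i dot ('d f x v) (E i) *: E i &
      forall phi : radial R m,
        (\forall y \near x, radial_fun phi (f x) <= radial_fun phi (f y)) ->
        0 <= \sum_i radial_hess phi (f x) (E i) -
             2^-1 * dot (radial_grad phi (f x)) (f x)].

Section Shrinker.
Context {R : realType} {n m : nat} {M : topologicalType}.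
Variables (A : set (chart R M n)) (X : M -> 'rV[R]_m).
Hypothesis atlasA : smooth_atlas A.
Hypothesis immX : immersion A X.

Lemma nbhs_chart_cod (c : chart R M n) x : chart_cod c x -> nbhs x (chart_cod c).
Proof. by move=> cx; apply: open_nbhs_nbhs; split => //; exact: chart_cod_open. Qed.

Lemma nbhs_chart_dom (c : chart R M n) p : chart_dom c p -> nbhs p (chart_dom c).
Proof. by move=> cp; apply: open_nbhs_nbhs; split => //; exact: chart_dom_open. Qed.

Lemma local_rep_C1 c x : A c -> chart_cod c x ->
  (\forall y \near x, C1_at (local_rep c X) y) /\
  forall k : 'I_n, C1_at ('D_(delta_mx 0 k) (local_rep c X)) x.
Proof.
by move=> Ac cx; apply: (smooth_on_C1_at (nbhs_chart_cod cx)); have [] := immX Ac.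
Qed.

Lemma immersion_continuous : continuous X.
Proof.
move=> p; have [c Ac cp] := atlasA.1 p.
have fc : {for chart_map c p, continuous (local_rep c X)}.
  apply: differentiable_continuous.
  by have [/nbhs_singleton/C1_at_diff[]] := local_rep_C1 Ac (chart_mapP cp).
have : {for p, continuous (local_rep c X \o chart_map c)}.
  by apply: continuous_comp => //; exact: chart_map_continuous.
rewrite /prop_for /continuous_at /= /local_rep /= chart_mapK//.
apply: cvg_trans; apply: near_eq_cvg.
apply: filterS (nbhs_chart_dom cp) => q cq /=.
by rewrite chart_mapK.
Qed.

Lemma near_transition (c d : chart R M n) (x : 'rV[R]_n) (Q : set 'rV[R]_n) :
  chart_cod c x -> chart_dom d (chart_param c x) ->
  nbhs (chart_map d (chart_param c x)) Q ->
  \forall y \near x, chart_dom d (chart_param c y) /\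
    Q (chart_map d (chart_param c y)).
Proof.
move=> cx dx Qx; have pc := chart_param_continuous cx.
have H : \forall q \near chart_param c x, chart_dom d q /\ Q (chart_map d q).
  apply: filterS2 (nbhs_chart_dom dx) (chart_map_continuous dx Qx) => q.
  by split.
exact: pc _ H.
Qed.

(** The frame of the mean curvature may come from another chart; the tangent
    space is the same by the chain rule. *)
Lemma diff_transition (c d : chart R M n) (x : 'rV[R]_n) : A c -> A d ->
  chart_cod c x -> chart_dom d (chart_param c x) ->
  forall v, exists u, 'd (local_rep c X) x v =
    'd (local_rep d X) (chart_map d (chart_param c x)) u.
Proof.
move=> Ac Ad cx dx v; set y := chart_map d _.
pose tau := chart_map d \o chart_param c.
have dy : chart_cod d y by exact: chart_mapP.
have xS : nbhs x (chart_cod c `&` chart_param c @^-1` chart_dom d).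
  apply: filterI; first exact: nbhs_chart_cod.
  exact: (chart_param_continuous cx (nbhs_chart_dom dx)).
have [/nbhs_singleton/C1_at_diff[tau_d _] _] :=
  smooth_on_C1_at xS (atlasA.2 c d Ac Ad).
have [/nbhs_singleton/C1_at_diff[fc_d _] _] := local_rep_C1 Ac cx.
have [/nbhs_singleton/C1_at_diff[fd_d _] _] := local_rep_C1 Ad dy.
exists ('d tau x v).
have fcE : \forall z \near x, local_rep c X z = (local_rep d X \o tau) z.
  by apply: filterS xS => z [_ dz]; rewrite /local_rep /tau /= chart_mapK.
transitivity ('D_v (local_rep c X) x); first by rewrite deriveE.
rewrite (near_eq_derive v fcE) deriveE; last exact: differentiable_comp.
exact: (congr1 (fun g => g v) (diff_comp tau_d fd_d)).
Qed.

(** The expression bounded below is [L (phi \o X)] for the drift Laplacian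
    [L = Delta - <X, grad>/2].  The gradient is normal at the minimum, so it
    pairs with the derivatives of the [E_i] as with their normal parts, whose
    sum is [H = - X^N/2], and with [X^N] as with [X]. *)
Lemma shrinker_radial_max_principle (c : chart R M n) (x : 'rV[R]_n) :
  self_shrinker A X -> A c -> chart_cod c x ->
  radial_max_principle_at (local_rep c X) x.
Proof.
move=> shr Ac cx; pose p := chart_param c x.
have [H [XN [Hp Np HE]]] := shr p.
case: Hp => d [W [e /= [[Ad dp] [Wo Wy Wd] [e_smooth e_orth] HH]]].
set f := local_rep d X in e_orth HH; set y := chart_map d p in Wy HH.
have dy : chart_cod d y by exact: chart_mapP.
have fy : f y = X p by rewrite /f /local_rep /= chart_mapK.
have [fC1 fC2] := local_rep_C1 Ad dy.
have dJ u : u *m 'J f y = 'd f y u by rewrite mul_rV_lin1.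
have ed i v : derivable (e i) y v.
  have [_ e1] := e_smooth i 1%N.
  by have [e1v _] := e1 v; exact: e1v.
pose E i := e i y *m 'J f y.
exists E; split.
- by move=> i j; rewrite /E !dJ; exact: e_orth.
- move=> v; have [u ->] := diff_transition Ac Ad cx dp v.
  rewrite -/p -/y -/f -dJ; apply: orthonormal_expansion => i j.
  by rewrite !dJ; exact: e_orth.
move=> phi; rewrite -[local_rep c X x]/(X p) => phi_min.
have {}phi_min : \forall z \near y,
    radial_fun phi (f y) <= radial_fun phi (f z).
  have cp : chart_dom c (chart_param d y).
    by rewrite /y chart_mapK//; exact: chart_paramP.
  have := near_transition (Q := [set z | radial_fun phi (X p) <=
    radial_fun phi (local_rep c X z)]) dy cp.
  rewrite {1}/y chart_mapK// chart_paramK// => /(_ phi_min).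
  apply: filterS => z [cz]; rewrite /local_rep /= chart_mapK//.
  by rewrite fy.
have [crit hess] := radial_min_frame fC1 fC2 ed phi_min.
have grad_normal v : dot (radial_grad phi (f y)) (normal_part ('J f y) v) =
    dot (radial_grad phi (f y)) v.
  by apply: dot_normal_part => u; rewrite dJ; exact: crit.
have : 0 <= \sum_i (radial_hess phi (f y) ('d f y (e i y)) +
    dot (radial_grad phi (f y)) ('D_(e i y) (Defs.pushforward f (e i)) y)).
  by apply: sumr_ge0.
have sumH : \sum_i dot (radial_grad phi (f y))
      ('D_(e i y) (Defs.pushforward f (e i)) y) =
    - (2^-1 * dot (radial_grad phi (f y)) (f y)).
  transitivity (dot (radial_grad phi (f y)) H).
    by rewrite HH dot_sumr; apply: eq_bigr => i _; rewrite grad_normal.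
  by rewrite HE (Np d Ad dp) dotNr dotZr grad_normal fy.
rewrite big_split /= sumH -fy.
by under [X in _ -> 0 <= X - _]eq_bigr do rewrite /E dJ.
Qed.

End Shrinker.

(** * The strong maximum principle *)

Lemma continuous_radial_fun (R : realType) (m : nat) (phi : radial R m) :
  continuous (radial_fun phi).
Proof.
move=> y; rewrite /radial_fun; apply: continuousD.
  by apply: continuous_dot; [exact: cst_continuous | exact: cvg_id].
have oc : {for y, continuous (offset phi)}.
  have zc : {for y, continuous (fun z : 'rV[R]_m => z - pole phi)}.
    by apply: continuousB; [exact: cvg_id | exact: cst_continuous].
  exact: (continuous_comp zc (@continuous_mulmxr _ _ _ (proj phi) _)).
have sc : {for y, continuous (sqdist phi)} by exact: continuous_dot.
have pc : {for sqdist phi y, continuous (profile phi)}.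
  apply/differentiable_continuous/derivable1_diffP.
  by have [] := profile_d phi (sqdist phi y).
exact: (continuous_comp sc pc).
Qed.

Lemma is_derive_scaled_exp (R : realType) (a b s : R) :
  is_derive s 1 (fun t => b * expR (a * t)) (a * (b * expR (a * s))).
Proof.
have lin : is_derive s 1 (fun t : R => a * t) a.
  by apply: (is_derive_eq (is_deriveZ a (is_derive_id s 1))); rewrite [LHS]mulr1.
have := is_derive1_comp (is_derive_expR (a * s)) lin.
move=> /(is_deriveZ b)/is_derive_eq; apply.
by rewrite [LHS]mulrC (mulrC _ a) -mulrA (mulrC _ b).
Qed.

Section TestFunctions.
Context {R : realType} {m : nat}.
Implicit Types w : 'rV[R]_m.

(** [y |-> <w, y> - c exp (- a |(y - Y) B|^2)]. *)
Definition gaussian_dip k w (Y : 'rV[R]_m) (B : 'M[R]_(m, k)) (c a : R) :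
    radial R m :=
  Radial w B Y (is_derive_scaled_exp (- a) (- c))
    (fun s => is_deriveZ (- a) (is_derive_scaled_exp (- a) (- c) s)).

Lemma is_derive_linear_profile (e s : R) :
  is_derive s 1 (fun t : R => e * t) e.
Proof.
by apply: (is_derive_eq (is_deriveZ e (is_derive_id s 1))); rewrite [LHS]mulr1.
Qed.

(** [y |-> <w, y> + e |y|^2]. *)
Definition paraboloid w (e : R) : radial R m :=
  Radial w 1%:M 0 (is_derive_linear_profile e)
    (fun s => is_derive_cst e s 1).

End TestFunctions.

Section StrongMaximumPrinciple.
Context {R : realType} {n m : nat}.
Implicit Types (f : 'rV[R]_n -> 'rV[R]_m) (w : 'rV[R]_m).

Lemma compact_norm_ball (x : 'rV[R]_n) (d : R) :
  compact [set y | `|x - y| <= d].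
Proof.
apply: bounded_closed_compact; last exact: closed_closed_ball_.
exists (`|x| + d); split; first exact: num_real.
move=> M xM y /= xy; apply: (le_trans _ (ltW xM)).
have -> : y = x - (x - y) by rewrite opprB addrC subrK.
by rewrite (le_trans (ler_normB _ _))// lerD2l.
Qed.

(** Ellipticity.  With [u = 'd f x v], the last hypothesis says that the
    derivative of [f *m B] is close to the identity; expanding [u] in the frame
    then shows that the vectors [E i *m B] cannot all be nearly orthogonal to
    [v]. *)
Lemma frame_gradient_lower_bound (B : 'M[R]_(m, n)) (E : 'I_n -> 'rV[R]_m)
    (u : 'rV[R]_m) (v : 'rV[R]_n) (C : R) : 0 < C ->
  u = \sum_i dot u (E i) *: E i ->
  dot u u <= C * dot v v -> dot v v <= 2 * dot v (u *m B) ->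
  dot v v <= 4 * C * \sum_i dot v (E i *m B) ^+ 2.
Proof.
move=> C0 uE uC vu; set Q := \sum_i _.
have TE : dot v (u *m B) = \sum_i dot u (E i) * dot v (E i *m B).
  rewrite {1}uE mulmx_suml dot_sumr; apply: eq_bigr => i _.
  by rewrite -scalemxAl dotZr.
(* Young's inequality with weight [2 * C], in the form of a sum of squares. *)
have young : 4 * C * dot v (u *m B) <= dot u u + 4 * C ^+ 2 * Q.
  rewrite (dot_expansion uE) TE /Q !mulr_sumr -big_split /=.
  apply: ler_sum => i _; rewrite -subr_ge0.
  set a := dot u _; set b := dot v _.
  have -> : a ^+ 2 + 4 * C ^+ 2 * b ^+ 2 - 4 * C * (a * b) =
    (a - 2 * C * b) ^+ 2 by ring.
  exact: sqr_ge0.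
rewrite -(ler_pM2l C0).
have : C * dot v v <= C * (2 * dot v (u *m B)) by rewrite ler_pM2l.
have -> : C * (4 * C * Q) = 4 * C ^+ 2 * Q by ring.
move: young uC; set T := dot v _; set s := dot v v; set r := dot u u.
by move=> *; lra.
Qed.

(** The dip [c exp (- a s)] makes the function smaller at [x0] than on the
    sphere [|x0 - x| = d], where [s] is larger, and it cannot outweigh the
    height, which is at least [c] where [s <= r]. *)
Lemma interior_min_of_gaussian_dip f w (x0 y : 'rV[R]_n) (B : 'M[R]_(m, n))
    (c a d r : R) : 0 < a -> 0 < c -> 0 < d ->
  let s x := sqdist (gaussian_dip w (f y) B c a) (f x) in
  (forall x, `|x0 - x| <= d -> {for x, continuous f}) ->
  dot w (f x0) = 0 ->
  (forall x, `|x0 - x| <= d -> 0 <= dot w (f x)) ->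
  (forall x, `|x0 - x| = d -> s x0 < s x) ->
  (forall x, `|x0 - x| <= d -> s x <= r -> c <= dot w (f x)) ->
  exists x, [/\ `|x0 - x| < d, r < s x & \forall z \near x,
    radial_fun (gaussian_dip w (f y) B c a) (f x) <=
    radial_fun (gaussian_dip w (f y) B c a) (f z)].
Proof.
move=> a0 c_gt0 d0 s fc fx0 f_ge0 s_bd s_in.
pose phi := gaussian_dip w (f y) B c a.
pose N : set 'rV[R]_n := [set x | `|x0 - x| <= d].
pose u x := radial_fun phi (f x).
have uE x : u x = dot w (f x) - c * expR (- a * s x).
  by rewrite /u /radial_fun /= mulNr.
have Nx0 : N x0 by rewrite /N /= subrr normr0 ltW.
have uc : {within N, continuous u}.
  apply: continuous_in_subspaceT => x; rewrite inE => Nx.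
  exact: (continuous_comp (fc x Nx) (@continuous_radial_fun _ _ phi _)).
have N0 : N !=set0 by exists x0.
have [x Nx xmin] := compact_EVT_min N0 (@compact_norm_ball x0 d) uc.
rewrite inE /N /= in Nx.
have ux : u x <= - (c * expR (- a * s x0)).
  by rewrite (le_trans (xmin x0 _)) ?inE// uE fx0 sub0r.
have xd : `|x0 - x| < d.
  rewrite lt_neqAle Nx andbT; apply/eqP => xd.
  have : expR (- a * s x) < expR (- a * s x0).
    by rewrite ltr_expR !mulNr ltrN2 ltr_pM2l// s_bd.
  rewrite -(ltr_pM2l c_gt0) => lt_e.
  by move: ux (f_ge0 x Nx) lt_e; rewrite uE => *; lra.
exists x; split => //.
  rewrite ltNge; apply/negP => /(s_in x Nx) cx.
  have e1 : expR (- a * s x) <= 1.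
    by rewrite -expR0 ler_expR mulNr oppr_le0 mulr_ge0 ?(ltW a0)// dotvv_ge0.
  have e0 : 0 < c * expR (- a * s x0) by rewrite mulr_gt0// expR_gt0.
  have : c * expR (- a * s x) <= c by rewrite ler_piMr ?(ltW c_gt0).
  by move: ux cx e0; rewrite uE => *; lra.
apply/nbhs_ballP; exists (d - `|x0 - x|); first by rewrite /= subr_gt0.
move=> z; rewrite -ball_normE /= => xz; apply: xmin; rewrite inE /N /=.
have := ler_normD (x0 - x) (x - z); rewrite subrKA => tri.
by lra.
Qed.

End StrongMaximumPrinciple.

Section ZeroLocus.
Context {R : realType} {n m : nat}.
Variables (f : 'rV[R]_n -> 'rV[R]_m) (w : 'rV[R]_m) (x0 : 'rV[R]_n).
Hypothesis fC1 : \forall x \near x0, C1_at f x.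
Hypothesis f_imm : row_free ('J f x0).

(** If [B] is a left inverse of ['d f x0], strict differentiability makes
    [f *m B] a small Lipschitz perturbation of the identity near [x0]. *)
Lemma local_left_inverse : exists (B : 'M[R]_(m, n)) (d C : R),
  [/\ 0 < d, 0 < C &
   forall x, `|x0 - x| < d ->
   [/\ forall y, `|x0 - y| < d ->
         `|x - y| <= 2 * `|(f x - f y) *m B| /\
         `|(f x - f y) *m B| <= 2 * `|x - y|,
       forall v, dot ('d f x v) ('d f x v) <= C * dot v v &
       forall v, dot v v <= 2 * dot v ('d f x v *m B)]].
Proof.
have [B JB] : exists B, 'J f x0 *m B = 1%:M.
  by exists (pinvmx ('J f x0)); exact: mulmxVp.
pose KB := m%:R * `|B| + 1.
have KB0 : 0 < KB by rewrite ltr_wpDl// mulr_ge0.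
have mulB (v : 'rV[R]_m) : `|v *m B| <= KB * `|v|.
  by rewrite (le_trans (mulmx_norm_le _ _))// ler_wpM2r// lerDl.
have dB v : 'd f x0 v *m B = v.
  have <- : v *m 'J f x0 = 'd f x0 v by rewrite mul_rV_lin1.
  by rewrite -mulmxA JB mulmx1.
(* The factor [n] is lost in comparing the sup norm with [dot]. *)
pose k : R := (2 * n.+1%:R)^-1.
have k0 : 0 < k by rewrite invr_gt0 mulr_gt0.
have k2 : k <= 2^-1.
  by rewrite lef_pV2 ?posrE ?mulr_gt0// ler_peMr// ler1n.
have nk : n%:R * k <= 2^-1.
  rewrite /k invfM mulrCA ler_piMr// ler_pdivrMr// mul1r ler_nat.
  exact: leqnSn.
have e0 : 0 < k / KB by rewrite divr_gt0.
have [d d0 fd] := C1_at_strict_diff fC1 e0.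
pose K1 := n%:R * `|'J f x0| + k / KB.
have K1_0 : 0 <= K1 by rewrite addr_ge0 ?(ltW e0)// mulr_ge0.
exists B, d, (m%:R * K1 ^+ 2 + 1); split => //.
  by rewrite ltr_wpDl// mulr_ge0// sqr_ge0.
move=> x /fd[fx dfx]; split.
- move=> y /fx H.
  have {}H : `|(f x - f y) *m B - (x - y)| <= k * `|x - y|.
    rewrite -{1}(dB (x - y)) -mulmxBl (le_trans (mulB _))//.
    by rewrite mulrC -ler_pdivlMr// mulrAC.
  have t1 := ler_normD ((f x - f y) *m B - (x - y)) (x - y).
  have t2 := ler_normB ((f x - f y) *m B) ((f x - f y) *m B - (x - y)).
  rewrite subrK in t1; rewrite subKr in t2.
  have kh : k * `|x - y| <= 2^-1 * `|x - y| by rewrite ler_wpM2r.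
  have p0 : 0 <= `|x - y| by [].
  by split; lra.
- move=> v.
  have : `|'d f x v| <= K1 * `|v|.
    rewrite -(subrK ('d f x0 v) ('d f x v)) (le_trans (ler_normD _ _))//.
    rewrite /K1 mulrDl [leRHS]addrC lerD//.
    have <- : v *m 'J f x0 = 'd f x0 v by rewrite mul_rV_lin1.
    exact: mulmx_norm_le.
  move=> dfv; have := norm_dot_le ('d f x v) ('d f x v).
  move=> /(le_trans (ler_norm _)) dd; apply: (le_trans dd).
  have v2 := sqr_norm_le_dot v.
  apply: (@le_trans _ _ (m%:R * (K1 ^+ 2 * dot v v))).
    rewrite ler_wpM2l// -expr2 (@le_trans _ _ ((K1 * `|v|) ^+ 2))//.
      by rewrite ler_sqr ?nnegrE ?mulr_ge0.
    by rewrite exprMn ler_wpM2l// sqr_ge0.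
  by rewrite mulrDl mul1r mulrA lerDl dotvv_ge0.
- move=> v.
  have H : `|'d f x v *m B - v| <= k * `|v|.
    rewrite -{2}(dB v) -mulmxBl (le_trans (mulB _))//.
    rewrite mulrC -ler_pdivlMr// mulrAC; exact: dfx.
  have : `|dot v ('d f x v *m B - v)| <= 2^-1 * dot v v.
    apply: (le_trans (norm_dot_le _ _)).
    apply: (@le_trans _ _ (n%:R * (`|v| * (k * `|v|)))).
      by rewrite ler_wpM2l// ler_wpM2l.
    have -> : n%:R * (`|v| * (k * `|v|)) = n%:R * k * `|v| ^+ 2 by ring.
    by rewrite ler_pM// ?mulr_ge0 ?(ltW k0)// ?sqr_ge0// sqr_norm_le_dot.
  rewrite dotBr ler_norml => /andP[+ _].
  by lra.
Qed.

(** The drift Laplacian of [- c exp (- a s)] is, up to the positive factor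
    [c a exp (- a s)], at most [- 4 a Q + O(1)], where [Q] is the sum of the
    squares of the derivatives of [s / 2] along the frame, bounded below by
    ellipticity away from [y]; it is negative for [a] large, and that of the
    height is not positive. *)
Lemma no_interior_min_gaussian_dip (B : 'M[R]_(m, n))
    (C K1 K2 r a c : R)
    (x y : 'rV[R]_n) :
  let phi := gaussian_dip w (f y) B c a in
  0 < C -> 0 < a -> 0 < c -> C * (2 * (n%:R * K1) + K2) <= a * r ->
  radial_max_principle_at f x -> 0 <= dot w (f x) ->
  (forall E : 'rV[R]_m, dot E E = 1 -> dot (E *m B) (E *m B) <= K1) ->
  `|dot (offset phi (f x)) (f x *m B)| <= K2 ->
  (forall v, dot ('d f x v) ('d f x v) <= C * dot v v) ->
  (forall v, dot v v <= 2 * dot v ('d f x v *m B)) ->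
  r < sqdist phi (f x) ->
  ~ (\forall z \near x, radial_fun phi (f x) <= radial_fun phi (f z)).
Proof.
move=> phi C0 a0 c0 CK [E [Eo Ex mpx]] h0 EK1 gK2 dfC dfB rs /mpx {mpx} mp.
set s := sqdist phi (f x) in rs mp; set g := offset phi (f x) in gK2 mp.
pose G : R := c * expR (- a * s).
have G0 : 0 < G by rewrite mulr_gt0// expR_gt0.
pose Q : R := \sum_i dot g (E i *m B) ^+ 2.
pose b : R := \sum_i dot (E i *m B) (E i *m B).
pose t : R := dot g (f x *m B).
have sQ : s <= 4 * C * Q.
  exact: (frame_gradient_lower_bound C0 (Ex g) (dfC g) (dfB g)).
have F1 : profile1 phi s = a * G by rewrite /phi /gaussian_dip /= /G; ring.
have F2 : profile2 phi s = - a ^+ 2 * G.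
  rewrite -[LHS]/(- a * (- a * (- c * expR (- a * s)))) /G; ring.
have hessE : \sum_i radial_hess phi (f x) (E i) =
    4 * (- a ^+ 2 * G) * Q + 2 * (a * G) * b.
  rewrite /Q /b !mulr_sumr -big_split /=; apply: eq_bigr => i _.
  by rewrite /radial_hess -/s -/g F1 F2.
have gradE : dot (radial_grad phi (f x)) (f x) = dot w (f x) + 2 * (a * G) * t.
  by rewrite dot_radial_grad -/s -/g F1.
have bK1 : b <= n%:R * K1.
  have -> : n%:R * K1 = \sum_(i < n) K1 by rewrite sumr_const card_ord mulr_natl.
  by apply: ler_sum => i _; apply: EK1; rewrite Eo eqxx.
have tK2 : - t <= K2 by move: gK2; rewrite ler_norml -/t => /andP[]; lra.
have aG0 : 0 < a * G by rewrite mulr_gt0.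
have aQ : 4 * a * Q <= 2 * b - t.
  rewrite -(ler_pM2l aG0) -subr_ge0.
  move: mp; rewrite hessE gradE; set L := _ - _ => L0.
  have -> : a * G * (2 * b - t) - a * G * (4 * a * Q) = L + 2^-1 * dot w (f x).
    by rewrite /L; field.
  by rewrite addr_ge0// mulr_ge0.
have : a * s <= C * (2 * (n%:R * K1) + K2).
  apply: (@le_trans _ _ (C * (4 * a * Q))).
    have -> : C * (4 * a * Q) = a * (4 * C * Q) by ring.
    by rewrite ler_pM2l.
  by rewrite ler_pM2l//; lra.
move=> /le_trans /(_ CK); rewrite ler_pM2l// leNgt => /negP; apply.
exact: rs.
Qed.

(** The constants are chosen in this order: the radius [d] of a ball around
    [x0] on which all local estimates hold; [d'] so small that any [y] within
    [d'] of [x0] is, in the distance [s], closer to [x0] than to the sphere of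
    radius [d]; then, for such a [y] with positive height, the dip [c], the
    level [r] of [s] below which the height exceeds [c], and the rate [a]. *)
Lemma zero_locus_nbhs : (\forall x \near x0, 0 <= dot w (f x)) ->
  (\forall x \near x0, radial_max_principle_at f x) ->
  dot w (f x0) = 0 -> \forall x \near x0, dot w (f x) = 0.
Proof.
move=> f_ge0 f_mp fx0.
have [B [d1 [C [d1_0 C0 dB]]]] := local_left_inverse.
have f_bd : \forall x \near x0, `|f x| <= `|f x0| + 1.
  have [df _] := C1_at_diff (nbhs_singleton fC1).
  have fc := differentiable_continuous df.
  have := @cvgr_dist_lt _ _ _ _ (nbhs_filter x0) _ _ fc _ (@ltr01 R).
  apply: filterS => x H; have := ler_normB (f x0) (f x0 - f x).
  by rewrite subKr => /le_trans; apply; rewrite lerD2l ltW.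
have : \forall x \near x0, [/\ C1_at f x, `|f x| <= `|f x0| + 1,
    0 <= dot w (f x) & radial_max_principle_at f x].
  by near=> x; split; near: x.
move=> /nbhs_ballP[d2 /= d2_0 good].
pose d := Num.min d1 d2 / 2.
have d0 : 0 < d by rewrite divr_gt0// lt_min d1_0.
have near_d x : `|x0 - x| <= d ->
  [/\ `|x0 - x| < d1, C1_at f x, `|f x| <= `|f x0| + 1, 0 <= dot w (f x) &
      radial_max_principle_at f x].
  move=> xd.
  have : `|x0 - x| < Num.min d1 d2.
    rewrite (le_lt_trans xd)// ltr_pdivrMr// mulr_natr mulr2n ltrDl.
    by rewrite lt_min d1_0.
  rewrite lt_min => /andP[xd1 xd2].
  by have [] := good x _; first rewrite -ball_normE.
pose N : R := n.+1%:R; have N1 : 1 <= N by rewrite ler1n.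
have N0 : 0 < N by rewrite ltr0n.
(* On the sphere [s >= (d / 4)^2], while [s x0 <= n * (2 * d')^2]. *)
pose d' := d / (8 * N).
have d'0 : 0 < d' by rewrite divr_gt0// mulr_gt0.
have d'd : 8 * d' <= d.
  by rewrite /d' invfM mulrCA (mulrA 8) mulfV// mul1r ler_pdivrMr// ler_peMr// ltW.
have Nd' : N * (8 * d') = d by rewrite /d'; field; rewrite gt_eqF.
apply/nbhs_ballP; exists d' => // y; rewrite -ball_normE /= => yd'.
have yd : `|x0 - y| <= d by lra.
have [y1 fy _ hy _] := near_d y yd.
apply/eqP; apply: contraT; rewrite neq_lt ltNge hy /= => hy0.
pose c := dot w (f y) / 2.
have c0 : 0 < c by rewrite divr_gt0.
have [r0 /= r0_0 fc] : exists2 r0, 0 < r0 & forall x, `|y - x| < r0 ->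
    c < dot w (f x).
  have hc : {for y, continuous (fun x => dot w (f x))}.
    apply: continuous_dot; first exact: cst_continuous.
    by apply: differentiable_continuous; have [] := C1_at_diff fy.
  have cy : c < dot w (f y) by rewrite /c ltr_pdivrMr// mulr_natr mulr2n ltrDl.
  have := @cvgr_gt _ _ _ (nbhs_filter y) _ _ hc _ cy.
  move=> /nbhs_ballP[r0 /= r00 H]; exists r0 => // x xr.
  by apply: H; rewrite -ball_normE.
pose r := (r0 / 4) ^+ 2.
have r_gt0 : 0 < r by rewrite exprn_gt0// divr_gt0.
pose KB := m%:R * `|B|.
have KB0 : 0 <= KB by rewrite mulr_ge0.
pose K1 := n%:R * KB ^+ 2.
pose K2 := n%:R * (4 * d * (KB * (`|f x0| + 1))).
pose K := 2 * (n%:R * K1) + K2.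
have K0 : 0 <= K.
  have d4 : 0 <= 4 * d by rewrite mulr_ge0// ltW.
  rewrite addr_ge0//; last by do 3!rewrite mulr_ge0//.
  by do 3!rewrite mulr_ge0//; exact: sqr_ge0.
pose a := C * (K + 1) / r.
have a0 : 0 < a by rewrite divr_gt0// mulr_gt0// ltr_wpDl.
pose phi := gaussian_dip w (f y) B c a.
have dist_le x : `|x0 - x| <= d -> `|x - y| <= 2 * `|offset phi (f x)| /\
    `|offset phi (f x)| <= 2 * `|x - y|.
  by move=> /near_d[xd1 _ _ _ _]; have [/(_ y y1) ? _ _] := dB x xd1.
have sq_le x : `|offset phi (f x)| ^+ 2 <= sqdist phi (f x).
  exact: sqr_norm_le_dot.
have [|||||x [xd rx x_min]] := @interior_min_of_gaussian_dip R n m f w x0 y B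
  c a d r a0 c0 d0.
- move=> x /near_d[_ fx _ _ _].
  by apply: differentiable_continuous; have [] := C1_at_diff fx.
- exact: fx0.
- by move=> x /near_d[].
- move=> x xd; rewrite -/phi.
  have [_ o0] : `|x0 - y| <= 2 * `|offset phi (f x0)| /\
    `|offset phi (f x0)| <= 2 * `|x0 - y|.
    by apply: dist_le; rewrite subrr normr0 ltW.
  have [ox _] : `|x - y| <= 2 * `|offset phi (f x)| /\
    `|offset phi (f x)| <= 2 * `|x - y| by apply: dist_le; rewrite xd.
  have tri := ler_distD y x0 x; rewrite xd (distrC y) in tri.
  have ox' : d / 4 <= `|offset phi (f x)| by lra.
  apply: lt_le_trans (sq_le x).
  apply: (@lt_le_trans _ _ ((d / 4) ^+ 2)); last first.
    by rewrite ler_sqr ?nnegrE//; lra.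
  apply: (le_lt_trans (ler_norm _)).
  apply: (le_lt_trans (norm_dot_le _ _)).
  have o0' : `|offset phi (f x0)| <= 2 * d' by lra.
  apply: (@le_lt_trans _ _ (n%:R * (2 * d' * (2 * d')))).
    by rewrite ler_wpM2l// ler_pM.
  apply: (@lt_le_trans _ _ (N * (2 * d' * (2 * d')))).
    have dd : 0 < 2 * d' * (2 * d') by do 2!rewrite mulr_gt0//.
    by rewrite (ltr_pM2r dd) /N ltr_nat.
  have -> : N * (2 * d' * (2 * d')) = d / 4 * (2 * d').
    by rewrite -Nd'; field.
  have d4 : 0 < d / 4 by lra.
  rewrite expr2 (ler_pM2l d4); lra.
- move=> x xd; rewrite -/phi => sx.
  apply/ltW/fc; rewrite distrC.
  have [ox _] := dist_le x xd.
  have : `|offset phi (f x)| <= r0 / 4.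
    rewrite -ler_sqr ?nnegrE//; last by lra.
    exact: le_trans (sq_le x) sx.
  by lra.
have [x1 _ fx hx mpx] := near_d x (ltW xd).
have [_ dfx dfxB] := dB x x1.
exfalso; apply: (@no_interior_min_gaussian_dip B C K1 K2 r a c x y C0 a0 c0
  _ mpx hx _ _ dfx dfxB rx x_min).
- by rewrite /a divfK ?gt_eqF// ler_pM2l// lerDl.
- move=> E E1; apply: (le_trans (ler_norm _)).
  apply: (le_trans (norm_dot_le _ _)); rewrite ler_wpM2l//.
  have EB : `|E *m B| <= KB.
    rewrite (le_trans (mulmx_norm_le _ _))// ler_piMr//.
    by rewrite -(@ler_sqr R) ?nnegrE// expr1n -E1 sqr_norm_le_dot.
  by rewrite expr2 ler_pM.
- apply: (le_trans (norm_dot_le _ _)); rewrite ler_wpM2l// ler_pM//.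
    have [_ ox] := dist_le x (ltW xd); rewrite -/phi (le_trans ox)//.
    have tri := ler_distD x0 x y; rewrite (distrC x x0) in tri.
    by lra.
  by rewrite (le_trans (mulmx_norm_le _ _))// ler_wpM2l.
Unshelve. all: by end_near. Qed.

End ZeroLocus.

(** * Halfspace theorem *)

Section Halfspace.
Context {R : realType} {n m : nat} {M : topologicalType}.
Variables (A : set (chart R M n)) (X : M -> 'rV[R]_m) (w : 'rV[R]_m).
Hypothesis atlasA : smooth_atlas A.
Hypothesis immX : immersion A X.
Hypothesis shrX : self_shrinker A X.
Hypothesis height_ge0 : forall p, 0 <= dot w (X p).

Let height p := dot w (X p).

Lemma height_continuous : continuous height.
Proof.
move=> p; apply: continuous_dot; first exact: cst_continuous.
exact: (immersion_continuous atlasA immX).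
Qed.

Lemma zero_height_open : open [set p | height p = 0].
Proof.
rewrite openE => p /= hp; have [c Ac cp] := atlasA.1 p.
have cx := chart_mapP cp.
have fXp : local_rep c X (chart_map c p) = X p.
  by rewrite /local_rep /= chart_mapK.
have zero : \forall x \near chart_map c p, dot w (local_rep c X x) = 0.
  apply: zero_locus_nbhs.
  - by have [] := local_rep_C1 immX Ac cx.
  - by have [_ H] := immX Ac; exact: H.
  - by apply: filterE => x; exact: height_ge0.
  - apply: filterS (nbhs_chart_cod cx) => x cx'.
    exact: (shrinker_radial_max_principle atlasA immX shrX Ac cx').
  - by rewrite fXp.
apply: filterS2 (nbhs_chart_dom cp) (chart_map_continuous cp zero) => q cq /=.
by rewrite /local_rep /= chart_mapK.
Qed.

Lemma positive_height_clopen :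
  open [set p | 0 < height p] /\ closed [set p | 0 < height p].
Proof.
split.
  rewrite openE => p /= hp.
  exact: (@cvgr_gt _ _ _ (nbhs_filter p) _ _ (@height_continuous p)).
rewrite (_ : [set p | 0 < height p] = ~` [set p | height p = 0]).
  exact/open_closedC/zero_height_open.
apply/seteqP; split => p /=; first by move=> h0 hp; rewrite hp ltxx in h0.
by move=> /eqP h0; rewrite lt_def h0; exact: height_ge0.
Qed.

(** [L (h + e |X|^2) = - h/2 + e (2 n - |X|^2)]. *)
Lemma paraboloid_min_bound (p : M) (e : R) : 0 < e ->
  (\forall q \near p, height p + e * dot (X p) (X p) <=
                      height q + e * dot (X q) (X q)) ->
  height p + 2 * e * dot (X p) (X p) <= 4 * e * n%:R.
Proof.
move=> e0 pmin; have [c Ac cp] := atlasA.1 p.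
have cx := chart_mapP cp; set x := chart_map c p in cx.
have fXp : local_rep c X x = X p by rewrite /local_rep /= chart_mapK.
pose phi := paraboloid w e.
have offE y : offset phi y = y by rewrite /offset /= subr0 mulmx1.
have phiE y : radial_fun phi y = dot w y + e * dot y y.
  by rewrite /radial_fun /sqdist offE.
have xmin : \forall z \near x,
    radial_fun phi (local_rep c X x) <= radial_fun phi (local_rep c X z).
  have pc := chart_param_continuous cx.
  rewrite /x in pc; rewrite /prop_for /continuous_at chart_mapK// in pc.
  have H : \forall z \near x, height p + e * dot (X p) (X p) <=
      height (chart_param c z) +
      e * dot (X (chart_param c z)) (X (chart_param c z)) := pc _ pmin.
  by apply: filterS H => z; rewrite fXp !phiE.
have [E [Eo _ /(_ phi xmin)]] := shrinker_radial_max_principle atlasA immX shrX Ac cx.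
rewrite fXp dot_radial_grad offE /= mulmx1.
have -> : \sum_i radial_hess phi (X p) (E i) = 2 * e * n%:R.
  rewrite mulr_natr -[n in RHS]card_ord -sumr_const; apply: eq_bigr => i _.
  by rewrite /radial_hess /= mulr0 mul0r add0r mulmx1 Eo eqxx mulr1.
by rewrite -[dot w (X p)]/(height p) => ?; lra.
Qed.

Lemma compact_dot_ball (r : R) : compact [set y : 'rV[R]_m | dot y y <= r].
Proof.
apply: bounded_closed_compact.
  exists (r + 1); split; first exact: num_real.
  move=> B rB y /= yr; apply: (le_trans _ (ltW rB)).
  have := sqr_norm_le_dot y; have := normr_ge0 y.
  by move=> *; nra.
apply: (@closed_comp _ _ (fun y : 'rV[R]_m => dot y y) [set s | s <= r]).
  by move=> y _; apply: continuous_dot; exact: cvg_id.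
exact: closed_le.
Qed.

Hypothesis properX : proper_map X.

Lemma height_eq0 p : height p = 0.
Proof.
have [Nop Ncl] := positive_height_clopen.
set N := [set p | 0 < height p] in Nop Ncl.
have Xc := immersion_continuous atlasA immX.
have N_compact r : compact (N `&` [set p | dot (X p) (X p) <= r]).
  rewrite setIC; apply: compact_closedI; last exact: Ncl.
  exact: properX (@compact_dot_ball r).
have norm_c : continuous (fun p => dot (X p) (X p)).
  by move=> q; apply: continuous_dot; exact: Xc.
apply/eqP; apply: contraT => hp0.
have Np : N p by rewrite /N /= lt_def hp0; exact: height_ge0.
have [c c0 hc] : exists2 c, 0 < c & forall q, N q ->
    dot (X q) (X q) <= 2 * n%:R -> c <= height q.
  set K := N `&` [set q | dot (X q) (X q) <= 2 * n%:R].
  have [K0|K0] := pselect (K !=set0); last first.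
    by exists 1 => // q Nq qn; exfalso; apply: K0; exists q.
  have [q] := compact_EVT_min K0 (@N_compact _)
    (continuous_subspaceT height_continuous).
  rewrite inE => -[Nq _] qmin; exists (height q) => // q' Nq' q'n.
  by apply: qmin; rewrite inE.
pose e := c / (4 * n.+1%:R).
have e0 : 0 < e by rewrite divr_gt0// mulr_gt0.
have ec : 4 * e * n%:R < c.
  have -> : c = 4 * e * n.+1%:R by
    rewrite -mulrA mulrCA /e divfK// mulf_neq0// pnatr_eq0.
  by rewrite ltr_pM2l ?mulr_gt0// ltr_nat.
pose u q := height q + e * dot (X q) (X q).
have uc : continuous u.
  move=> q; apply: cvgD; first exact: height_continuous.
  by apply: cvgM; [exact: cvg_cst | exact: norm_c].
pose K := N `&` [set q | dot (X q) (X q) <= u p / e].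
have Kp : K p.
  split => //=; rewrite ler_pdivlMr// mulrC /u lerDr; exact: height_ge0.
have K0 : K !=set0 by exists p.
have [q] := compact_EVT_min K0 (@N_compact _)
  (continuous_subspaceT uc).
rewrite inE => -[Nq _] qmin.
have {}qmin q' : N q' -> u q <= u q'.
  move=> Nq'; have [q'K|q'K] := leP (dot (X q') (X q')) (u p / e).
    by apply: qmin; rewrite inE.
  apply: (le_trans (qmin p _)); first by rewrite inE.
  move: q'K; rewrite ltr_pdivrMr// => /ltW /le_trans; apply.
  by rewrite /u mulrC lerDr; exact: height_ge0.
have : \forall q' \near q, u q <= u q'.
  by apply: filterS (open_nbhs_nbhs (conj Nop Nq)) => q' /qmin.
move=> /(paraboloid_min_bound e0) bound.
have h0 : 0 <= height q by exact: height_ge0.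
have := hc q Nq; have := dotvv_ge0 (X q) => d0 hq.
have : dot (X q) (X q) <= 2 * n%:R.
  have e2 : 0 < 2 * e by rewrite mulr_gt0.
  rewrite -(ler_pM2l e2).
  have -> : 2 * e * (2 * n%:R) = 4 * e * n%:R by ring.
  by lra.
move=> /hq cq; have : 0 <= 2 * e * dot (X q) (X q) by rewrite !mulr_ge0// ltW.
by move=> *; exfalso; lra.
Qed.

End Halfspace.

Theorem theorem6 (R : realType) (n m : nat) (hnm : (n < m)%N)
    (M : topologicalType) (A : set (chart R M n)) (X : M -> 'rV[R]_m)
    (hM : smooth_manifold A)
    (himm : immersion A X)
    (hcomplete : complete_submanifold A X)
    (hproper : proper_map X)
    (hshrinker : self_shrinker A X)
    (P : set 'rV[R]_m) (hP : linear_hyperplane P)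
    (H : set 'rV[R]_m) (hH : closed_halfspace_of P H)
    (hXH : range X `<=` H) :
  range X `<=` P.
Proof.
have [_ _ atlasA] := hM.
have [w [_ PE HE]] := hH.
have hw p : 0 <= dot w (X p) by have : H (X p) by [exact: hXH]; rewrite HE.
by rewrite PE => _ [p _ <-] /=; exact: (height_eq0 atlasA himm hshrinker hw hproper).
Qed.
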